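(* Let $E$ be a vector space over $\mathbb K$ ($\mathbb R$ or $\mathbb C$), let $(\mathbf S_n)_{n\ge 0}$ be a sequence in $E$, let $\mathbf y\in E^*$, and let $\boldsymbol{\widehat\varepsilon}_{2k}^{(n)}=\mathbf{\widehat e}_k(\mathbf S_n)\in E$ denote the first topological Shanks transforms of $(\mathbf S_n)$. Let $\varepsilon_k^{(n)}$ be the scalars obtained by applying the scalar $\varepsilon$-algorithm to the sequence of numbers $S_n=\langle \mathbf y,\mathbf S_n\rangle$. Then $\boldsymbol{\widehat\varepsilon}_0^{(n)}=\mathbf S_n$ for all $n\ge 0$, and for all $k,n=0,1,\ldots$ the following (equivalent) relations hold: $$\boldsymbol{\widehat\varepsilon}_{2k+2}^{(n)}=\boldsymbol{\widehat\varepsilon}_{2k}^{(n+1)}+\frac{1}{(\varepsilon_{2k}^{(n+1)}-\varepsilon_{2k}^{(n)})(\varepsilon_{2k+1}^{(n+1)}-\varepsilon_{2k+1}^{(n)})}\,(\boldsymbol{\widehat\varepsilon}_{2k}^{(n+1)}-\boldsymbol{\widehat\varepsilon}_{2k}^{(n)}),$$ $$\boldsymbol{\widehat\varepsilon}_{2k+2}^{(n)}=\boldsymbol{\widehat\varepsilon}_{2k}^{(n+1)}+\frac{\varepsilon_{2k+1}^{(n)}-\varepsilon_{2k-1}^{(n+1)}}{\varepsilon_{2k+1}^{(n+1)}-\varepsilon_{2k+1}^{(n)}}\,(\boldsymbol{\widehat\varepsilon}_{2k}^{(n+1)}-\boldsymbol{\widehat\varepsilon}_{2k}^{(n)}),$$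 $$\boldsymbol{\widehat\varepsilon}_{2k+2}^{(n)}=\boldsymbol{\widehat\varepsilon}_{2k}^{(n+1)}+\frac{\varepsilon_{2k+2}^{(n)}-\varepsilon_{2k}^{(n+1)}}{\varepsilon_{2k}^{(n+1)}-\varepsilon_{2k}^{(n)}}\,(\boldsymbol{\widehat\varepsilon}_{2k}^{(n+1)}-\boldsymbol{\widehat\varepsilon}_{2k}^{(n)}),$$ $$\boldsymbol{\widehat\varepsilon}_{2k+2}^{(n)}=\boldsymbol{\widehat\varepsilon}_{2k}^{(n+1)}+(\varepsilon_{2k+1}^{(n)}-\varepsilon_{2k-1}^{(n+1)})(\varepsilon_{2k+2}^{(n)}-\varepsilon_{2k}^{(n+1)})\,(\boldsymbol{\widehat\varepsilon}_{2k}^{(n+1)}-\boldsymbol{\widehat\varepsilon}_{2k}^{(n)}),$$ $$\boldsymbol{\widehat\varepsilon}_{2k+2}^{(n)}=\frac{\varepsilon_{2k+2}^{(n)}-\varepsilon_{2k}^{(n)}}{\varepsilon_{2k}^{(n+1)}-\varepsilon_{2k}^{(n)}}\boldsymbol{\widehat\varepsilon}_{2k}^{(n+1)}-\frac{\varepsilon_{2k+2}^{(n)}-\varepsilon_{2k}^{(n+1)}}{\varepsilon_{2k}^{(n+1)}-\varepsilon_{2k}^{(n)}}\boldsymbol{\widehat\varepsilon}_{2k}^{(n)}=\boldsymbol{\widehat\varepsilon}_{2k}^{(n)}+\frac{\varepsilon_{2k+2}^{(n)}-\varepsilon_{2k}^{(n)}}{\varepsilon_{2k}^{(n+1)}-\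varepsilon_{2k}^{(n)}}\,(\boldsymbol{\widehat\varepsilon}_{2k}^{(n+1)}-\boldsymbol{\widehat\varepsilon}_{2k}^{(n)}).$$
   Context: $E^*$ is the algebraic dual of $E$ and $\langle\cdot,\cdot\rangle$ the duality product. $\Delta$ is the forward difference operator, $\Delta \mathbf S_n=\mathbf S_{n+1}-\mathbf S_n$. First topological Shanks transformation: for $k,n\ge 0$, let $a_0^{(n,k)},\ldots,a_k^{(n,k)}\in\mathbb K$ be the solution of the linear system $\sum_{i=0}^k a_i^{(n,k)}=1$ and $\sum_{i=0}^k a_i^{(n,k)}\langle\mathbf y,\Delta\mathbf S_{n+j+i}\rangle=0$ for $j=0,\ldots,k-1$. Then $\mathbf{\widehat e}_k(\mathbf S_n)=a_0^{(n,k)}\mathbf S_n+\cdots+a_k^{(n,k)}\mathbf S_{n+k}$. Scalar $\varepsilon$-algorithm applied to a sequence of numbers $(S_n)$: $\varepsilon_{-1}^{(n)}=0$, $\varepsilon_0^{(n)}=S_n$, $\varepsilon_{k+1}^{(n)}=\varepsilon_{k-1}^{(n+1)}+(\varepsilon_k^{(n+1)}-\varepsilon_k^{(n)})^{-1}$ for $k,n=0,1,\ldots$. Convention: all quantities involved are assumed to be defined (the linear systems are uniquely solvable and the denominators are nonzero). *)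

(* Defs.v *)
From HB Require Import structures.
From mathcomp Require Import all_boot all_order all_algebra.
From mathcomp Require Import classical_sets.

Set Implicit Arguments.
Unset Strict Implicit.
Unset Printing Implicit Defensive.

Import GRing.Theory.
Local Open Scope ring_scope.

Definition fdiff (V : zmodType) (u : nat -> V) (n : nat) : V := u n.+1 - u n.

Section TopologicalShanks.
Variables (K : fieldType) (E : lmodType K).
Variables (y : {scalar E}) (S : nat -> E).

Definition shanks_system (k n : nat) (a : 'rV[K]_k.+1) : Prop :=
  \sum_(i < k.+1) a 0 i = 1 /\
  forall j : 'I_k, \sum_(i < k.+1) a 0 i * y (fdiff S (n + j + i)) = 0.

Definition shanks_solvable (k n : nat) : Prop :=
  exists! a : 'rV[K]_k.+1, shanks_system n a.

(* A junk value (0) when the system has no solution; only meaningful under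
   [shanks_solvable k n]. *)
Definition shanks_coef (k n : nat) : 'rV[K]_k.+1 :=
  xget 0 [set a : 'rV[K]_k.+1 | shanks_system n a]%classic.

(* The vector usually written e-hat_k(S_n), or eps-hat with lower index 2k and
   upper index (n). *)
Definition top_shanks1 (k n : nat) : E :=
  \sum_(i < k.+1) shanks_coef k n 0 i *: S (n + i).

End TopologicalShanks.

Section ScalarEpsilon.
Variables (K : fieldType) (s : nat -> K).

(* The lower index is shifted by one: [eps_shift k n] is the entry of lower
   index k - 1 and upper index n. *)
Fixpoint eps_shift (k : nat) : nat -> K :=
  match k with
  | 0 => fun _ => 0
  | k1.+1 =>
    match k1 with
    | 0 => s
    | k2.+1 => fun n =>
        eps_shift k2 n.+1 + (eps_shift k1 n.+1 - eps_shift k1 n)^-1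
    end
  end.

(* All negative lower indices give 0, but only -1 is used. *)
Definition eps (k : int) (n : nat) : K :=
  match k with
  | Posz j => eps_shift j.+1 n
  | Negz _ => 0
  end.

Lemma epsN1 n : eps (-1) n = 0.
Proof. by []. Qed.

Lemma eps0 n : eps 0 n = s n.
Proof. by []. Qed.

Lemma epsS (k n : nat) :
  eps k.+1 n = eps (k%:Z - 1) n.+1 + (eps k n.+1 - eps k n)^-1.
Proof.
case: k => [//|k]; have -> // : k.+1%:Z - 1 = k%:Z.
by rewrite intS addrC addKr.
Qed.

(* The entries (j, m) that are differenced and inverted when the entry (k, n)
   is computed are those with n <= m and j + m < n + k. *)
Definition eps_defined (k n : nat) : Prop :=
  forall j m : nat, (n <= m)%N -> (j + m < n + k)%N ->
    eps j m.+1 - eps j m != 0.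

End ScalarEpsilon.

(* Main.v *)
Require Import Defs.
From HB Require Import structures.
From mathcomp Require Import all_boot all_order all_algebra.
From mathcomp Require Import classical_sets ring zify.

Set Implicit Arguments.
Unset Strict Implicit.
Unset Printing Implicit Defensive.

Import GRing.Theory.
Local Open Scope ring_scope.

(** The coefficients of a Shanks transform form a polynomial [A_k^(n)] with
value 1 at 1, orthogonal to [X^j], [j < k], for the functional
[X^i |-> <y, Delta S_(n+i)>]. Such polynomials are produced by an epsilon-like
recurrence: [P_(-1) = 0], [P_0 = 1] and
[P_(j+1)^(n) = X P_(j-1)^(n+1) + w_j P_j^(n) / (eps_j^(n+1) - eps_j^(n))],
where [w_j] is [1] for [j] even and [X - 1] for [j] odd. By induction
[P_j^(n+1) - P_j^(n)] is [(eps_j^(n+1) - eps_j^(n)) w_(j+1) P_(j-1)^(n+1)], so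
[w_(j+1) (eps_j^(n+1) - eps_j^(n)) P_(j+1)^(n)] equals
[X P_j^(n+1) - P_j^(n)]; the latter form gives the orthogonality relations, the
recurrence gives the value [<y, .> = eps_(2k)^(n)], whence [A_k = P_(2k)].
Combining both forms expresses [P_(2k+2)^(n)] by [X P_(2k)^(n+1)] and
[P_(2k)^(n)], which is the first relation. *)

(** * Polynomials generated by the scalar epsilon-algorithm *)

Section EpsilonPolynomials.
Variables (K : fieldType) (s : nat -> K).

Definition deps (j n : nat) : K := eps s j n.+1 - eps s j n.

Definition eps_weight (j : nat) : {poly K} := if odd j then 'X - 1 else 1.

Lemma eps_weight_even k : eps_weight k.*2 = 1.
Proof. by rewrite /eps_weight odd_double. Qed.

Lemma eps_weight_odd k : eps_weight k.*2.+1 = 'X - 1.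
Proof. by rewrite /eps_weight /= odd_double. Qed.

Lemma eps_weightM j : eps_weight j * eps_weight j.+1 = 'X - 1.
Proof. by rewrite /eps_weight /=; case: odd; rewrite ?mulr1 ?mul1r. Qed.

(* As in [eps_shift], the lower index is shifted by one: [eps_poly k n] is
   [P_(k-1)^(n)]. *)
Fixpoint eps_poly (k n : nat) : {poly K} :=
  match k with
  | 0 => 0
  | k1.+1 =>
    match k1 with
    | 0 => 1
    | k2.+1 => 'X * eps_poly k2 n.+1
               + (deps k2 n)^-1 *: (eps_weight k2 * eps_poly k1 n)
    end
  end.

Lemma eps_polySS k n :
  eps_poly k.+2 n = 'X * eps_poly k n.+1
    + (deps k n)^-1 *: (eps_weight k * eps_poly k.+1 n).
Proof. by []. Qed.

Lemma depsS j n :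
  deps j.+2 n = deps j n.+1 + (deps j.+1 n.+1)^-1 - (deps j.+1 n)^-1.
Proof. by rewrite /deps /=; ring. Qed.

Lemma eps_definedW k n k' n' : (n <= n')%N -> (n' + k' <= n + k)%N ->
  eps_defined s k n -> eps_defined s k' n'.
Proof. by move=> le_n le_k def j m le_m lt_jm; apply: def; lia. Qed.

Lemma eps_poly_diff j n : eps_defined s j.+1 n ->
  eps_poly j.+1 n.+1 - eps_poly j.+1 n
    = deps j n *: (eps_weight j.+1 * eps_poly j n.+1).
Proof.
elim/ltn_ind: j n => -[|[|j]] IH n def.
- by rewrite /= subrr mulr0 scaler0.
- rewrite !eps_polySS /= !mulr0 !add0r !mulr1 -scalerBl.
  by rewrite {3}/deps /= !add0r.
have d1 : deps j.+1 n != 0 by apply: def; lia.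
have d0 : deps j n.+1 != 0 by apply: def; lia.
have defn : eps_defined s j.+2 n by apply: eps_definedW def; lia.
have defnS : eps_defined s j.+1 n.+1 by apply: eps_definedW def; lia.
have IH1 := IH j.+1 (ltnSn _) n defn.
have IH0 := IH j (ltnW (ltnSn _)) n.+1 defnS.
have wSS i : eps_weight i.+2 = eps_weight i by rewrite /eps_weight /= negbK.
rewrite [eps_poly j.+3 n.+1]eps_polySS [eps_poly j.+3 n]eps_polySS depsS.
rewrite opprD addrACA -mulrBr IH0.
(* Everything is reduced to [P_(j+1)^(n+1)] and [P_j^(n+1)]: the terms in the latter cancel, and the
   former keeps the coefficient [deps j.+2 n] as expanded by [depsS]. *)
have -> : eps_poly j.+2 n
    = eps_poly j.+2 n.+1 - deps j.+1 n *: (eps_weight j * eps_poly j.+1 n.+1).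
  by rewrite -(wSS j) -IH1 subKr.
have XP : 'X * eps_poly j n.+2
    = eps_poly j.+2 n.+1
      - (deps j n.+1)^-1 *: (eps_weight j * eps_poly j.+1 n.+1).
  by rewrite eps_polySS addrK.
rewrite wSS -scalerAr mulrCA XP !(mulrBr, scalerBr) -!scalerAr !scalerA.
rewrite mulfV // mulVf // !scale1r [RHS]scalerBl [in RHS]scalerDl opprB.
by rewrite [X in _ + X]addrCA subrKA addrA.
Qed.

(** Multiplying the recurrence by [w_(j+1)] puts [w_j w_(j+1) = X - 1] in front of [P_j^(n)];
    [eps_poly_diff] accounts for the remaining term. *)
Lemma eps_poly_XB j n : eps_defined s j.+1 n ->
  deps j n *: (eps_weight j.+1 * eps_poly j.+2 n)
    = 'X * eps_poly j.+1 n.+1 - eps_poly j.+1 n.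
Proof.
move=> def; have d0 : deps j n != 0 by apply: def; lia.
have [-> ->] : eps_poly j.+1 n.+1 = eps_poly j.+1 n
    + deps j n *: (eps_weight j.+1 * eps_poly j n.+1)
  /\ eps_poly j.+2 n = 'X * eps_poly j n.+1
    + (deps j n)^-1 *: (eps_weight j * eps_poly j.+1 n).
  by rewrite -eps_poly_diff // addrC subrK.
have w2 p : eps_weight j.+1 * (eps_weight j * p) = 'X * p - p.
  by rewrite mulrA (mulrC (eps_weight _)) eps_weightM mulrBl mul1r.
rewrite !mulrDr scalerDr -!scalerAr scalerA mulfV // scale1r w2.
by rewrite (mulrCA 'X) addrA [X in _ = X - _]addrC.
Qed.

(** Only odd weights raise the degree, and the factor [X] comes with an index jump of two; so
    [P_(2k)] has degree at most [k]. *)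
Lemma size_eps_poly j n : (size (eps_poly j n) <= uphalf j)%N.
Proof.
elim/ltn_ind: j n => -[|[|j]] IH n; rewrite ?size_poly0 ?size_poly1 //.
rewrite eps_polySS (leq_trans (size_polyD _ _)) // geq_max.
have sX := IH j ltac:(lia) n.+1; have sP := IH j.+1 ltac:(lia) n.
apply/andP; split.
  by rewrite (leq_trans (size_polyMleq _ _)) // size_polyX; exact: sX.
rewrite (leq_trans (size_scale_leq _ _)) //.
have sw : (size (eps_weight j) <= (odd j).+1)%N.
  by rewrite /eps_weight; case: odd; rewrite ?size_poly1 // size_XsubC.
by rewrite (leq_trans (size_polyMleq _ _)) //; lia.
Qed.

(** The weight entering [P_(2k+2)] vanishes at 1, so the value there is inherited from [P_(2k)]. *)
Lemma eps_poly1 k n : (eps_poly k.*2.+1 n).[1] = 1.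
Proof.
elim: k n => [|k IH] n; first by rewrite /= hornerE.
have root1 : (eps_weight k.*2.+1).[1] = 0.
  by rewrite eps_weight_odd hornerD hornerN hornerX hornerC subrr.
rewrite doubleS eps_polySS hornerD hornerZ !hornerM hornerX root1 IH.
by rewrite mul0r mulr0 mulr1 addr0.
Qed.

End EpsilonPolynomials.

(** * Polynomials in the shift operator acting on a sequence *)

Section ShiftComb.
Variables (K : fieldType) (E : lmodType K) (S : nat -> E).

(** This is [p(shift)] applied to [S], read at index [n]. *)
Definition shift_comb n (p : {poly K}) : E :=
  \sum_(i < size p) p`_i *: S (n + i).

Lemma shift_comb_widen n N (p : {poly K}) : (size p <= N)%N ->
  shift_comb n p = \sum_(i < N) p`_i *: S (n + i).
Proof.
move=> le_pN; rewrite /shift_comb.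
rewrite (big_ord_widen N (fun i => p`_i *: S (n + i))) //.
rewrite big_mkcond; apply: eq_bigr => i _; case: ltnP => // le_pi.
by rewrite nth_default // scale0r.
Qed.

Fact shift_comb_is_linear n : linear (shift_comb n).
Proof.
move=> c p q; pose N := maxn (size (c *: p + q)) (maxn (size p) (size q)).
rewrite !(@shift_comb_widen _ N) ?leq_max ?leqnn ?orbT //.
rewrite scaler_sumr -big_split; apply: eq_bigr => i _ /=.
by rewrite coefD coefZ scalerDl scalerA.
Qed.

HB.instance Definition _ n := GRing.isLinear.Build K {poly K} E *:%R
  (shift_comb n) (shift_comb_is_linear n).

Lemma shift_combXM n p : shift_comb n ('X * p) = shift_comb n.+1 p.
Proof.
rewrite (@shift_comb_widen _ (size p).+1); last first.
  by rewrite (leq_trans (size_polyMleq _ _)) // size_polyX.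
rewrite big_ord_recl coefXM scale0r add0r; apply: eq_bigr => i _.
by rewrite coefXM /= addnS.
Qed.

Lemma shift_combXnM n j p : shift_comb n ('X^j * p) = shift_comb (n + j) p.
Proof.
elim: j n => [|j IH] n; first by rewrite mul1r addn0.
by rewrite exprS -mulrA shift_combXM IH addnS.
Qed.

Lemma shift_comb1 n : shift_comb n 1 = S n.
Proof. by rewrite /shift_comb size_poly1 big_ord1 coef1 scale1r addn0. Qed.

End ShiftComb.

(** The forward difference is the shift minus the identity. *)
Lemma shift_comb_fdiff (K : fieldType) (E : lmodType K) (S : nat -> E) n p :
  shift_comb (fdiff S) n p = shift_comb S n (('X - 1) * p).
Proof.
rewrite mulrBl mul1r raddfB /= shift_combXM /shift_comb -sumrB.
by apply: eq_bigr => i _; rewrite /fdiff scalerBr.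
Qed.

(** * Shanks transforms through orthogonal polynomials *)

Section EpsilonShanks.
Variables (K : fieldType) (E : lmodType K) (y : {scalar E}) (S : nat -> E).

Let s n := y (S n).
Let L n p := y (shift_comb S n p).

Let LXM n p : L n ('X * p) = L n.+1 p.
Proof. by rewrite /L shift_combXM. Qed.

Let LB n p q : L n (p - q) = L n p - L n q.
Proof. by rewrite /L !raddfB. Qed.

Let LD n p q : L n (p + q) = L n p + L n q.
Proof. by rewrite /L !raddfD. Qed.

Let LZ n c p : L n (c *: p) = c * L n p.
Proof. by rewrite /L !linearZ. Qed.

(** The Shanks system for a coefficient polynomial: the normalisation becomes the value at 1, the
    difference a factor [X - 1], the offset [j] a factor [X^j]. *)
Definition shanks_poly k n (p : {poly K}) : Prop :=
  [/\ (size p <= k.+1)%N, p.[1] = 1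
    & forall j, (j < k)%N -> L n ('X^j * (('X - 1) * p)) = 0].

Lemma shanks_poly_system k n p : shanks_poly k n p ->
  shanks_system y S n (\row_(i < k.+1) p`_i).
Proof.
case=> sz p1 orth; split=> [|j].
  rewrite -p1 (horner_coef_wide _ sz); apply: eq_bigr => i _.
  by rewrite mxE expr1n mulr1.
rewrite -[RHS](orth j (ltn_ord j)) /L shift_combXnM -shift_comb_fdiff.
rewrite (shift_comb_widen _ _ sz) raddf_sum; apply: eq_bigr => i _.
by rewrite mxE /= linearZ_LR.
Qed.

Lemma top_shanks1_poly k n p : shanks_solvable y S k n -> shanks_poly k n p ->
  top_shanks1 y S k n = shift_comb S n p.
Proof.
move=> [a [_ uniq]] pP; have [sz _ _] := pP.
have sys := shanks_poly_system pP.
(* By [sys] a solution exists, so [xget] returns one and not its default 0; uniqueness identifies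
   it. *)
have coefE : shanks_coef y S k n = \row_(i < k.+1) p`_i.
  rewrite -(uniq _ sys); apply/esym/uniq.
  exact: (@xgetI _ 0 [set b | shanks_system y S n b]%classic _ sys).
rewrite (shift_comb_widen _ _ sz); apply: eq_bigr => i _.
by rewrite coefE mxE.
Qed.

Lemma shanks_solvable0 n : shanks_solvable y S 0 n.
Proof.
exists (const_mx 1); split.
  by split=> [|[]//]; rewrite big_ord1 mxE.
move=> a [sum1 _]; apply/rowP => i; rewrite ord1 mxE -sum1.
by rewrite big_ord1.
Qed.

Let eps_poly_even_spec k n :=
  L n (eps_poly s k.*2.+1 n) = eps s k.*2 n /\
  forall j, (j < k)%N -> L n ('X^j * (('X - 1) * eps_poly s k.*2.+1 n)) = 0.

(* Degree [0] holds by the values of [P_(2k)]; the orthogonality of [P_(2k)]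
   then carries the value [1] to the higher degrees. *)
Let eps_poly_odd k n : eps_defined s k.*2.+1 n ->
  eps_poly_even_spec k n -> eps_poly_even_spec k n.+1 ->
  forall j, (j <= k)%N -> L n ('X^j * (('X - 1) * eps_poly s k.*2.+2 n)) = 1.
Proof.
move=> def [val orth] [valS orthS].
have d0 : deps s k.*2 n != 0 by apply: def; lia.
have rec := eps_poly_XB def; rewrite eps_weight_odd in rec.
elim=> [|j IH] lt_jk.
  by apply: (mulfI d0); rewrite mul1r -LZ rec LB LXM val valS mulr1.
rewrite -[RHS](IH (ltnW lt_jk)); apply/eqP; rewrite -subr_eq0 -LB.
rewrite exprS -mulrA -{2}['X^j * _]mul1r -mulrBl mulrCA.
apply/eqP; apply: (mulfI d0); rewrite mulr0 -LZ 2!scalerAr rec.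
by rewrite !mulrBr LB 2![_ * ('X * _)]mulrCA LXM orth // orthS // subrr.
Qed.

(** The value follows the scalar rule term by term. Orthogonality holds because
    [X P_(2k+1)^(n+1) - P_(2k+1)^(n)], paired with [X^j (X - 1)], gives 1 - 1 by [eps_poly_odd]. *)
Lemma eps_poly_even k n : eps_defined s k.*2 n -> eps_poly_even_spec k n.
Proof.
elim: k n => [|k IH] n def.
  by split=> //; rewrite /L shift_comb1.
have def1 : eps_defined s k.*2.+1 n by apply: eps_definedW def; lia.
have def1S : eps_defined s k.*2.+1 n.+1 by apply: eps_definedW def; lia.
have [s0 s1 s2] : [/\ eps_poly_even_spec k n, eps_poly_even_spec k n.+1
                    & eps_poly_even_spec k n.+2].
  by split; apply: IH; apply: eps_definedW def; lia.
have d1 : deps s k.*2.+1 n != 0 by apply: def; lia.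
have F := eps_poly_odd def1 s0 s1; have FS := eps_poly_odd def1S s1 s2.
split.
  rewrite doubleS eps_polySS LD LXM LZ (proj1 s1) eps_weight_odd.
  have := F 0 (leq0n k); rewrite mul1r => ->.
  by rewrite mulr1.
move=> j le_jk; apply: (mulfI d1); rewrite mulr0 -LZ !scalerAr.
have := @eps_poly_XB K s k.*2.+1 n def.
rewrite -!doubleS eps_weight_even mul1r => ->.
by rewrite !mulrBr LB 2![_ * ('X * _)]mulrCA LXM F // FS // subrr.
Qed.

Lemma eps_poly_shanks k n : eps_defined s k.*2 n ->
  shanks_poly k n (eps_poly s k.*2.+1 n).
Proof.
move=> def; split; last by case: (eps_poly_even def).
  by rewrite -[X in (_ <= X.+1)%N]doubleK; exact: size_eps_poly.
exact: eps_poly1.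
Qed.

Lemma top_shanks1_eps_poly k n :
  shanks_solvable y S k n -> eps_defined s k.*2 n ->
  top_shanks1 y S k n = shift_comb S n (eps_poly s k.*2.+1 n).
Proof. by move=> sol def; apply/top_shanks1_poly/eps_poly_shanks. Qed.

Lemma top_shanks1_rec k n :
  shanks_solvable y S k n -> shanks_solvable y S k n.+1 ->
  shanks_solvable y S k.+1 n -> eps_defined s k.*2.+2 n ->
  top_shanks1 y S k.+1 n = top_shanks1 y S k n.+1
    + (deps s k.*2 n * deps s k.*2.+1 n)^-1
      *: (top_shanks1 y S k n.+1 - top_shanks1 y S k n).
Proof.
move=> sol solS sol1 def.
have def1 : eps_defined s k.*2.+1 n by apply: eps_definedW def; lia.
rewrite !top_shanks1_eps_poly //; [|by apply: eps_definedW def; lia..].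
have d0 : deps s k.*2 n != 0 by apply: def; lia.
(* Once all terms are at index [n], the claim is the recurrence for [P_(2k+2)], with its
   [(X - 1) P_(2k+1)] rewritten by [eps_poly_XB]. *)
rewrite -!shift_combXM -raddfB -(eps_poly_XB def1) -linearZ -raddfD.
congr shift_comb; rewrite doubleS eps_polySS; congr (_ + _).
rewrite scalerA invfM mulrAC mulVf // mul1r.
by rewrite eps_weight_odd.
Qed.

End EpsilonShanks.

Theorem mainTheorem1 (K : fieldType) (E : lmodType K)
    (S : nat -> E) (y : {scalar E}) :
  let ehat := top_shanks1 y S in
  let e := eps (fun n => y (S n)) in
  (forall n : nat, ehat 0%N n = S n) /\
  (forall k n : nat,
     shanks_solvable y S k n ->
     shanks_solvable y S k n.+1 ->
     shanks_solvable y S k.+1 n ->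
     eps_defined (fun n => y (S n)) (2 * k).+2 n ->
     ehat k.+1 n
       = ehat k n.+1
         + (1 / ((e (2 * k)%N n.+1 - e (2 * k)%N n)
                 * (e (2 * k).+1 n.+1 - e (2 * k).+1 n)))
             *: (ehat k n.+1 - ehat k n)
     /\
     ehat k.+1 n
       = ehat k n.+1
         + ((e (2 * k).+1 n - e ((2 * k)%N%:Z - 1) n.+1)
            / (e (2 * k).+1 n.+1 - e (2 * k).+1 n))
             *: (ehat k n.+1 - ehat k n)
     /\
     ehat k.+1 n
       = ehat k n.+1
         + ((e (2 * k).+2 n - e (2 * k)%N n.+1)
            / (e (2 * k)%N n.+1 - e (2 * k)%N n))
             *: (ehat k n.+1 - ehat k n)
     /\
     ehat k.+1 n
       = ehat k n.+1
         + ((e (2 * k).+1 n - e ((2 * k)%N%:Z - 1) n.+1)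
            * (e (2 * k).+2 n - e (2 * k)%N n.+1))
             *: (ehat k n.+1 - ehat k n)
     /\
     ehat k.+1 n
       = ((e (2 * k).+2 n - e (2 * k)%N n)
          / (e (2 * k)%N n.+1 - e (2 * k)%N n)) *: ehat k n.+1
         - ((e (2 * k).+2 n - e (2 * k)%N n.+1)
            / (e (2 * k)%N n.+1 - e (2 * k)%N n)) *: ehat k n
     /\
     ehat k.+1 n
       = ehat k n
         + ((e (2 * k).+2 n - e (2 * k)%N n)
            / (e (2 * k)%N n.+1 - e (2 * k)%N n))
             *: (ehat k n.+1 - ehat k n)).
Proof.
move=> ehat e; split=> [n|k n sol solS sol1 def].
  rewrite /ehat (top_shanks1_eps_poly (shanks_solvable0 y S n)) ?shift_comb1 //.
  (* For lower index 0 the range in [eps_defined] is empty. *)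
  by move=> j m; lia.
have rec : ehat k.+1 n = ehat k n.+1
    + ((e (2 * k)%N n.+1 - e (2 * k)%N n)
       * (e (2 * k).+1 n.+1 - e (2 * k).+1 n))^-1 *: (ehat k n.+1 - ehat k n).
  by rewrite mul2n; apply: top_shanks1_rec => //; rewrite -mul2n.
have d0 : e (2 * k)%N n.+1 - e (2 * k)%N n != 0 by apply: def; lia.
(* The scalar rule at indices 2k+1 and 2k+2 trades inverse differences for differences, which makes
   the forms equivalent. *)
have eo : e (2 * k).+1 n - e ((2 * k)%N%:Z - 1) n.+1
    = (e (2 * k)%N n.+1 - e (2 * k)%N n)^-1.
  by rewrite {1}/e epsS addrC addKr.
have ee : e (2 * k).+2 n - e (2 * k)%N n.+1
    = (e (2 * k).+1 n.+1 - e (2 * k).+1 n)^-1.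
  by rewrite {1}/e epsS -addn1 PoszD addrK addrC addKr.
have ee0 : e (2 * k).+2 n - e (2 * k)%N n
    = (e (2 * k).+2 n - e (2 * k)%N n.+1) + (e (2 * k)%N n.+1 - e (2 * k)%N n).
  by rewrite addrA subrK.
have rec2 : ehat k.+1 n = ehat k n
    + ((e (2 * k).+2 n - e (2 * k)%N n)
       / (e (2 * k)%N n.+1 - e (2 * k)%N n)) *: (ehat k n.+1 - ehat k n).
  (* The ratio is 1 plus the coefficient of the third form; the 1 moves the base point from
     [ehat k n.+1] to [ehat k n]. *)
  rewrite ee0 mulrDl mulfV // scalerDl scale1r ee -invfM mulrC rec.
  by rewrite [RHS]addrCA [in RHS]subrKC addrC.
split; first by rewrite div1r.
split; first by rewrite eo -invfM.
split; first by rewrite ee rec invfM mulrC.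
split; first by rewrite eo ee rec invfM.
split; last by [].
rewrite rec2 [X in _ = _ - X *: _](_ : _ =
  (e (2 * k).+2 n - e (2 * k)%N n) / (e (2 * k)%N n.+1 - e (2 * k)%N n) - 1).
  by rewrite scalerBr scalerBl scale1r opprB addrCA.
by rewrite ee0 [in RHS]mulrDl mulfV // addrK.
Qed.
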